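(* Let $\Delta$ be a thick building endowed with an arbitrary system $\mathcal{A}$ of apartments. Let $C$ and $D$ be two adjacent chambers of $\Delta$. Then the set consisting of $C$, $D$ and all their faces is the intersection of all apartments in $\mathcal{A}$ which contain both $C$ and $D$.
   Context: Buildings are finite-dimensional simplicial complexes (chamber complexes admitting a system of apartments satisfying Tits' axioms), of arbitrary type. Chambers are the maximal simplices, panels the simplices of codimension 1; $\Delta$ is thick if each panel is contained in at least three chambers. Two chambers are adjacent if they are different and share a common panel. A system of apartments of $\Delta$ is any subset $\mathcal{A}$ of the complete (maximal) apartment system such that any two chambers of $\Delta$ are contained in some member of $\mathcal{A}$. *)

(* Defs.v *)
From mathcomp Require Import all_boot finmap.
From mathcomp Require Import boolp classical_sets.

Set Implicit Arguments.
Unset Strict Implicit.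
Unset Printing Implicit Defensive.

Local Open Scope classical_set_scope.

Section Buildings.
Variable V : choiceType.

(* A complex is given by its set of simplices, the empty simplex included.
   The vertices of K are the v with K [fset v]%fset; they need not exhaust V,
   so that the subcomplexes of K live over the same type V. *)
Implicit Types (K S : set {fset V}) (A B C D E P : {fset V}) (f : V -> V).

Definition simplicial_complex K : Prop :=
  K fset0 /\ forall A B, K A -> (B `<=` A)%fset -> K B.

Definition chamber K C : Prop :=
  K C /\ forall B, K B -> (C `<=` B)%fset -> B = C.

Definition panel K P : Prop :=
  exists C, [/\ chamber K C, (P `<=` C)%fset & #|` C| = (#|` P|).+1].

Definition adjacent K C D : Prop :=
  [/\ chamber K C, chamber K D, C <> D &
      exists P, [/\ panel K P, (P `<=` C)%fset & (P `<=` D)%fset]].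

Definition gallery_connected K : Prop :=
  forall C D, chamber K C -> chamber K D ->
  exists (n : nat) (c : nat -> {fset V}),
    [/\ c 0 = C, c n = D & forall i, i < n -> adjacent K (c i) (c i.+1)].

(* Here d is the dimension plus one. *)
Definition chamber_complex K : Prop :=
  [/\ simplicial_complex K,
      exists d : nat, (forall A, K A -> #|` A| <= d) /\
                      (forall C, chamber K C -> #|` C| = d)
    & gallery_connected K].

Definition thin K : Prop :=
  forall P, panel K P -> exists C D, C <> D /\
    forall E, (chamber K E /\ (P `<=` E)%fset) <-> (E = C \/ E = D).

Definition thick K : Prop :=
  forall P, panel K P -> exists C D E,
    [/\ C <> D, C <> E & D <> E] /\
    [/\ chamber K C /\ (P `<=` C)%fset,
        chamber K D /\ (P `<=` D)%fset
      & chamber K E /\ (P `<=` E)%fset].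

(* Only the values of f on the vertices of K matter. *)
Definition chamber_endomorphism K f : Prop :=
  (forall A, K A -> K (f @` A)%fset) /\
  (forall C, chamber K C -> chamber K (f @` C)%fset).

Definition folding K f : Prop :=
  [/\ chamber_endomorphism K f,
      forall v, K [fset v]%fset -> f (f v) = f v
    & forall C, chamber K C -> exists D E, D <> E /\
        forall B, (chamber K B /\ (f @` B = f @` C)%fset) <-> (B = D \/ B = E)].

(* Tits' definition: the image of the folding is a root containing C and
   not D. These are, up to isomorphism, the complexes of standard cosets of
   Coxeter systems of finite rank. *)
Definition coxeter_complex K : Prop :=
  [/\ chamber_complex K, thin K &
      forall C D, adjacent K C D ->
        exists f, folding K f /\ (f @` D = C)%fset].

(* Injectivity is required on vertices of S, surjectivity on simplices of S';
   together they make the inverse map simplicial as well. *)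
Definition complex_isomorphism S S' f : Prop :=
  [/\ forall u v, S [fset u]%fset -> S [fset v]%fset -> f u = f v -> u = v,
      forall A, S A -> S' (f @` A)%fset
    & forall B, S' B -> exists2 A, S A & (f @` A = B)%fset].

Definition apartment_axioms K (AA : set (set {fset V})) : Prop :=
  [/\ forall S, AA S -> S `<=` K /\ coxeter_complex S,
      forall A B, K A -> K B -> exists S, [/\ AA S, S A & S B]
    & forall S S' A B, AA S -> AA S' -> S A -> S B -> S' A -> S' B ->
        exists f, [/\ complex_isomorphism S S' f,
                      forall v, v \in A -> f v = v
                    & forall v, v \in B -> f v = v]].

Definition building K : Prop :=
  chamber_complex K /\ exists AA, apartment_axioms K AA.

(* The complete system is the largest one, obtained as the union of all
   families satisfying the axioms. *)
Definition complete_apartment_system K : set (set {fset V}) :=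
  [set S | exists2 AA, apartment_axioms K AA & AA S].

Definition apartment_system K (AA : set (set {fset V})) : Prop :=
  AA `<=` complete_apartment_system K /\
  forall C D, chamber K C -> chamber K D -> exists S, [/\ AA S, S C & S D].

End Buildings.

(* Main.v *)
(* Let x be a vertex, outside C and D, of an apartment S of the system that
   contains C and D. Among the chambers of S containing x take one, B, nearest
   to {C, D}, say at distance n from C. The folding of S onto the root of C
   shows that d(D,B) = n+1. Let E be the last but one chamber of a minimal
   gallery from C to B, and let B' be a third chamber on the panel Q of E and B.
   The retraction onto S centred at E maps B' to B, whence d(D,B') = n+1, and
   D, C, ..., E, B' is a minimal gallery. By convexity an apartment of the system
   containing D and B' also contains C and E; it does not contain x, since
   otherwise it would contain B and three chambers on Q. Finally, a simplex with
   vertices in C and D lies in C or in D, because the folding of D onto C would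
   collapse an edge joining the vertex of C not in D to that of D not in C. *)
Require Import Defs.
From mathcomp Require Import all_boot finmap zify.
From mathcomp Require Import boolp classical_sets.

Set Implicit Arguments.
Unset Strict Implicit.
Unset Printing Implicit Defensive.

Local Open Scope classical_set_scope.

Section Apartments.
Variables (V : choiceType) (d : nat).
Local Open Scope fset_scope.
Implicit Types (K S : set {fset V}) (A B C D E P Q X : {fset V}).
Implicit Types (f g : V -> V) (u v w : V).

(** * Simplices, chambers and panels by cardinality *)

Lemma eq_fset_card A B : A `<=` B -> #|` A| = #|` B| -> A = B.
Proof. by move=> AB eqAB; apply/eqP; rewrite eqEfcard AB eqAB leqnn. Qed.

Lemma corank1_eq P A u v : P `<=` A -> #|` A| = (#|` P|).+1 ->
  u \in A -> v \in A -> u \notin P -> v \notin P -> u = v.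
Proof.
move=> PA cA uA vA uP vP.
have /cardfs1P[w Dw] : #|` A `\` P| == 1 by rewrite cardfsDS // cA subSnn.
have /fset1P-> : u \in [fset w] by rewrite -Dw inE uP.
by have /fset1P-> : v \in [fset w] by rewrite -Dw inE vP.
Qed.

Lemma sub_imfset f A B : A `<=` B -> f @` A `<=` f @` B.
Proof. by move=> AB; apply/subset_imfset/fsubsetP. Qed.

Lemma imfset_fixed f A : (forall v, v \in A -> f v = v) -> f @` A = A.
Proof.
by move=> fA; rewrite -[RHS]imfset_id; apply: eq_in_imfset => // v /fA.
Qed.

(** Shared by the building and its apartments, with one and the same [d], the dimension plus one. *)
Definition ranked K : Prop :=
  [/\ simplicial_complex K, forall A, K A -> #|` A| <= d
    & forall C, chamber K C -> #|` C| = d].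

(** Maximality depends on the complex, the number of vertices does not; so chambers pass easily
    between an apartment and the building. *)
Definition top_simplex K C : Prop := K C /\ #|` C| = d.

Definition adj K C D : Prop :=
  [/\ top_simplex K C, top_simplex K D, C <> D & #|` C `&` D|.+1 = d].

Lemma sub_simplex K A B : ranked K -> K A -> B `<=` A -> K B.
Proof. by case=> -[_ sK] _ _; apply: sK. Qed.

Lemma vertex_simplex K A v : ranked K -> K A -> v \in A -> K [fset v].
Proof. by move=> rK KA vA; apply: sub_simplex KA _; rewrite ?fsub1set. Qed.

Lemma chamberE K C : ranked K -> chamber K C <-> top_simplex K C.
Proof.
move=> [sK leK cK]; split=> [cC|[KC cC]]; first by split; [case: cC|exact: cK].
split=> // B KB CB; apply/esym/eqP; rewrite eqEfcard CB cC; exact: leK.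
Qed.

Lemma in_top_simplex K A : ranked K -> K A ->
  exists2 C, top_simplex K C & A `<=` C.
Proof.
move=> rK; have [_ leK _] := rK.
have [n] := ubnP (d - #|` A|); elim: n A => // n IHn A ltn KA.
have [cA|ncA] := pselect (chamber K A).
  by exists A => //; apply/chamberE.
have [B [KB AB neB]] : exists B, [/\ K B, A `<=` B & B <> A].
  apply: contrapT => nB; apply: ncA; split=> // B KB AB.
  by apply: contrapT => neB; apply: nB; exists B.
have ltAB : #|` A| < #|` B|.
  by apply: fproper_ltn_card; rewrite fproperEneq AB andbT eq_sym; apply/eqP.
have [|C topC BC] := IHn B _ KB; last by exists C => //; apply: fsubset_trans BC.
by have := leK _ KB; move: ltn ltAB; rewrite !ltnS; lia.
Qed.

Lemma top_inter_card C D : #|` C| = d -> #|` D| = d -> C <> D ->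
  #|` C `&` D| < d.
Proof.
move=> cC cD neCD; rewrite -cC; apply: fproper_ltn_card.
rewrite fproperEneq fsubsetIl andbT; apply/eqP => eqI; apply: neCD.
by apply: eq_fset_card; rewrite ?cC ?cD // -eqI fsubsetIr.
Qed.

Lemma adj_of_sub K C D P : top_simplex K C -> top_simplex K D -> C <> D ->
  P `<=` C -> P `<=` D -> #|` P|.+1 = d -> adj K C D.
Proof.
move=> tC tD neCD PC PD cP; split=> //.
have := top_inter_card tC.2 tD.2 neCD.
have : #|` P| <= #|` C `&` D| by apply: fsubset_leq_card; rewrite fsubsetI PC.
by move: cP; lia.
Qed.

Lemma adjC K C D : adj K C D -> adj K D C.
Proof. by case=> tC tD ne c; split=> //; [exact/nesym|rewrite fsetIC]. Qed.

Lemma panel_card K P : ranked K -> panel K P -> #|` P|.+1 = d.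
Proof. by move=> [_ _ cK] [C [/cK <- _ ->]]. Qed.

Lemma panelI K C P : ranked K -> top_simplex K C -> P `<=` C ->
  #|` P|.+1 = d -> panel K P.
Proof.
by move=> rK tC PC cP; exists C; split; rewrite ?cP ?tC.2 //; apply/chamberE.
Qed.

Lemma adjacentE K C D : ranked K -> adjacent K C D <-> adj K C D.
Proof.
move=> rK; split=> [[/(chamberE _ rK) tC /(chamberE _ rK) tD ne]|adjCD].
  by move=> [P [/(panel_card rK) cP PC PD]]; apply: adj_of_sub cP.
have [tC tD ne cP] := adjCD; split; try exact/chamberE; first by [].
exists (C `&` D); split; rewrite ?fsubsetIl ?fsubsetIr //.
by apply: (panelI rK tC); rewrite ?fsubsetIl.
Qed.

(** * Panels of thin complexes, and galleries *)

Section Thin.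
Variables (S : set {fset V}) (rS : ranked S) (thS : thin S).

Lemma thin_third P A B E : #|` P|.+1 = d ->
  top_simplex S A -> top_simplex S B -> top_simplex S E ->
  P `<=` A -> P `<=` B -> P `<=` E -> A <> B -> E <> A -> E = B.
Proof.
move=> cP tA tB tE PA PB PE neAB neEA.
have [C [D [neCD CD]]] := thS (panelI rS tA PA cP).
have toCD X : top_simplex S X -> P `<=` X -> X = C \/ X = D.
  by move=> tX PX; apply/CD; split=> //; apply/chamberE.
have := toCD A tA PA; have := toCD B tB PB; have := toCD E tE PE.
by move=> [] ? [] ? [] ?; subst.
Qed.

Lemma thin_other P A : #|` P|.+1 = d -> top_simplex S A -> P `<=` A ->
  exists B, [/\ top_simplex S B, P `<=` B & B <> A].
Proof.
move=> cP tA PA; have [C [D [neCD CD]]] := thS (panelI rS tA PA cP).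
have [/(chamberE _ rS) tC PC] := (CD C).2 (or_introl erefl).
have [/(chamberE _ rS) tD PD] := (CD D).2 (or_intror erefl).
have [eqAC|neAC] := pselect (C = A); last by exists C.
by exists D; split=> // eqDA; apply: neCD; rewrite eqAC eqDA.
Qed.

End Thin.

(* Stuttering is allowed, so this says that the distance is at most [n]. *)
Fixpoint near K n C D : Prop :=
  if n is m.+1 then exists2 E, near K m C E & E = D \/ adj K E D else C = D.

Lemma nearS K n C D : near K n C D -> near K n.+1 C D.
Proof. by exists D => //; left. Qed.

Lemma near_cat K n m C D E : near K n C D -> near K m D E ->
  near K (n + m) C E.
Proof.
move=> nCD; elim: m E => [|m IHm] E /=; first by move <-; rewrite addn0.
by move=> [A nDA AE]; rewrite addnS; exists A => //; apply: IHm.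
Qed.

Lemma near_adj K n C D E : adj K C D -> near K n D E -> near K n.+1 C E.
Proof. by move=> CD; rewrite -add1n; apply: near_cat; exists C => //; right. Qed.

Lemma near_sub K K' n C D : (K `<=` K')%classic -> near K n C D -> near K' n C D.
Proof.
move=> KK'; elim: n D => //= n IHn D [E /IHn nCE ED]; exists E => //.
case: ED => [|[tE tD ne c]]; [by left|right; split=> //].
  by case: tE => /KK'.
by case: tD => /KK'.
Qed.

Lemma near_top K n C D : top_simplex K C -> near K n C D -> top_simplex K D.
Proof.
by case: n => [|n] tC /=; [move <-|elim: n D => [|n IHn] D [E];
  [move=> <- [<-|[]]|move=> /IHn tE [<-|[]]]].
Qed.

Lemma gallery_near K C D : ranked K -> gallery_connected K ->
  top_simplex K C -> top_simplex K D -> exists n, near K n C D.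
Proof.
move=> rK gK tC tD.
have [n [c [<- <- adjc]]] := gK C D ((chamberE _ rK).2 tC) ((chamberE _ rK).2 tD).
exists n; elim: n adjc => //= n IHn adjc.
exists (c n); last by right; apply/adjacentE/adjc.
by apply: IHn => i ltin; apply: adjc; apply: leqW.
Qed.

(** * Chamber maps and their rigidity *)

Definition chamber_map K S f : Prop :=
  forall A, top_simplex K A -> top_simplex S (f @` A).

Section ChamberMap.
Variables (K S : set {fset V}) (f : V -> V) (fP : chamber_map K S f).

Lemma chamber_map_inj A : top_simplex K A -> {in A &, injective f}.
Proof.
by move=> tA; apply/card_in_imfsetP; rewrite (fP tA).2 tA.2.
Qed.

Lemma chamber_map_card A P : top_simplex K A -> P `<=` A ->
  #|` f @` P| = #|` P|.
Proof.
move=> /chamber_map_inj injA /fsubsetP PA; rewrite card_in_imfset //=.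
by move=> u v /PA uA /PA vA; apply: injA.
Qed.

Lemma chamber_map_adj A B : adj K A B ->
  f @` A = f @` B \/ adj S (f @` A) (f @` B).
Proof.
move=> [tA tB ne cP]; have [|neI] := pselect (f @` A = f @` B); first by left.
right; apply: (@adj_of_sub _ _ _ (f @` (A `&` B))) => //; try exact: fP.
- exact/sub_imfset/fsubsetIl.
- exact/sub_imfset/fsubsetIr.
- by rewrite (chamber_map_card tA) ?fsubsetIl.
Qed.

Lemma chamber_map_near n A B : near K n A B -> near S n (f @` A) (f @` B).
Proof.
elim: n B => [|n IHn] B /=; first by move->.
move=> [E /IHn nAE EB]; exists (f @` E) => //.
by case: EB => [->|/chamber_map_adj //]; left.
Qed.

End ChamberMap.

Definition vertex_inj S f : Prop :=
  forall u v, S [fset u] -> S [fset v] -> f u = f v -> u = v.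

Lemma vertex_inj_imfset S f A B : ranked S -> vertex_inj S f ->
  S A -> S B -> f @` A = f @` B -> A = B.
Proof.
move=> rS injf SA SB eqAB; apply/fsetP.
have sub X Y : S X -> S Y -> f @` X = f @` Y -> {subset X <= Y}.
  move=> SX SY eqXY u uX; have : f u \in f @` Y by rewrite -eqXY in_imfset.
  case/imfsetP=> v /= vY /injf-> //; exact: vertex_simplex uX || exact: vertex_simplex vY.
by move=> u; apply/idP/idP; apply: sub.
Qed.

Lemma isomorphism_chamber_map S S' f : ranked S ->
  complex_isomorphism S S' f -> chamber_map S S' f.
Proof.
move=> rS [injf fS _] A [SA cA]; split; first exact: fS.
rewrite card_in_imfset //= => u v uA vA; apply: injf.
  exact: vertex_simplex uA.
exact: vertex_simplex vA.
Qed.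

(** Agreement spreads along a gallery from [E]. If [f] and [g] agree on [B], both images of an
    adjacent [A] contain the image of the common panel and, by injectivity, differ from that of [B];
    thinness makes them equal, and the vertex of [A] off the panel has only one possible image. *)
Lemma rigidity S S' f g E A : ranked S -> ranked S' -> gallery_connected S ->
  thin S' -> chamber_map S S' f -> chamber_map S S' g ->
  vertex_inj S f -> vertex_inj S g -> top_simplex S E ->
  (forall v, v \in E -> f v = g v) -> top_simplex S A ->
  forall v, v \in A -> f v = g v.
Proof.
move=> rS rS' gS thS' fP gP fI gI tE eqE tA.
have [n] := gallery_near rS gS tE tA.
elim: n A tA => [|n IHn] A tA /=; first by move <-.
move=> [B nEB [<-|adjBA]]; first by apply: IHn => //; exact: near_top nEB.
have [tB _ neBA cP] := adjBA.
have {IHn nEB} eqB := IHn B tB nEB.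
have sIA : B `&` A `<=` A := fsubsetIr _ _.
have sIB : B `&` A `<=` B := fsubsetIl _ _.
have eqBi : g @` B = f @` B by apply: eq_in_imfset => // u /eqB.
have eqIi : g @` (B `&` A) = f @` (B `&` A).
  by apply: eq_in_imfset => // u /(fsubsetP sIB) /eqB.
have eqA : g @` A = f @` A.
  apply: (@thin_third _ rS' thS' (f @` (B `&` A)) (f @` B)); try exact: fP;
    try exact: gP; try exact: sub_imfset.
  - by rewrite (chamber_map_card fP tB).
  - by rewrite -eqIi; apply: sub_imfset.
  - by move/(vertex_inj_imfset rS fI tB.1 tA.1).
  - by rewrite -eqBi => /(vertex_inj_imfset rS gI tA.1 tB.1) /esym.
move=> v vA; have [vB|vB] := boolP (v \in B); first exact: eqB.
have /imfsetP[u /= uA eq_u] : f v \in g @` A by rewrite eqA in_imfset.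
rewrite eq_u; congr g; apply: (@corank1_eq (B `&` A) A) => //.
- by rewrite cP tA.2.
- apply: contra vB; rewrite inE => /andP[uB _].
  suff <- : u = v by [].
  apply: fI; [exact: vertex_simplex rS tA.1 uA|exact: vertex_simplex rS tA.1 vA|].
  by rewrite eqB.
- by rewrite inE (negPf vB).
Qed.

(** A simplex of [S] with [d] vertices is maximal in [K], hence in [S]; this forces the rank of [S]
    to be [d]. *)
Lemma apartment_facts K AA S E : ranked K -> apartment_axioms K AA -> AA S ->
  S E -> #|` E| = d ->
  [/\ (S `<=` K)%classic, ranked S, gallery_connected S & thin S].
Proof.
move=> rK [AAcox _ _] AS SE cE.
have [SK [[sS [d' [leS cS]] gS] thS _]] := AAcox S AS.
have cham : chamber S E.
  have [_ maxE] : chamber K E by apply/chamberE => //; split=> //; exact: SK.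
  by split=> // B /SK; apply: maxE.
have eqd : d' = d by rewrite -(cS _ cham).
by split=> //; rewrite /ranked -eqd.
Qed.

(** * Retractions onto an apartment, and convexity *)

Definition retraction K S E f : Prop :=
  [/\ forall A, K A -> S (f @` A), chamber_map K S f,
      forall v, S [fset v] -> f v = v & forall B, K B -> f @` B = E -> B = E].

(** The isomorphisms onto [S] of the apartments through [E] that fix [E] agree on common vertices,
    so they glue. Only [E] lies over [E] because each of them is injective on vertices. *)
Lemma exists_retraction K AA S E : ranked K -> apartment_axioms K AA -> AA S ->
  top_simplex S E -> exists f, retraction K S E f.
Proof.
move=> rK axK AS tE; have [SE cE] := tE; have [AAcox AAex AAiso] := axK.
have [SK rS gS thS] := apartment_facts rK axK AS SE cE.
pose chart S' f := [/\ AA S', S' E, complex_isomorphism S' S f &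
  forall v, v \in E -> f v = v].
have chart_uniq S1 f1 S2 f2 v : chart S1 f1 -> chart S2 f2 ->
    S1 [fset v] -> S2 [fset v] -> f1 v = f2 v.
  move=> [A1 E1 i1 fix1] [A2 E2 i2 fix2] S1v S2v.
  have [_ r1 g1 _] := apartment_facts rK axK A1 E1 cE.
  have [_ r2 _ _] := apartment_facts rK axK A2 E2 cE.
  (* As [g] fixes both [E] and [v], it is enough to compare [f1] with [f2 \o g]: both map [S1] to
     [S] and fix [E]. *)
  have [g [ig gE gv]] := AAiso S1 S2 E [fset v] A1 A2 E1 S1v E2 S2v.
  have cm1 := isomorphism_chamber_map r1 i1.
  have cm2 := isomorphism_chamber_map r2 i2.
  have cmg := isomorphism_chamber_map r1 ig.
  have [A tA vA] := in_top_simplex r1 S1v.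
  transitivity (f2 (g v)); last by rewrite gv ?inE.
  apply: (@rigidity S1 S f1 (f2 \o g) E A) => //.
  - by move=> B tB; rewrite imfset_comp; apply/cm2/cmg.
  - by case: i1.
  - case: i2 ig => [inj2 _ _] [injg simg _] u w Su Sw /inj2 eqg.
    apply: injg => //; apply: eqg.
      by rewrite -imfset_fset1; apply: simg.
    by rewrite -imfset_fset1; apply: simg.
  - by move=> u uE; rewrite /= gE // fix1 // fix2.
  - by rewrite -fsub1set.
have /choice[r rP] : forall v, exists w, forall S' f,
    chart S' f -> S' [fset v] -> f v = w.
  move=> v.
  have [[S' [f [cf Sv]]]|no] := pselect (exists S' f, chart S' f /\ S' [fset v]).
    by exists (f v) => S'' f' cf' Sv'; apply: (chart_uniq _ _ _ _ _ cf' cf).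
  (* Default value, for a [v] on which no chart is defined. *)
  by exists v => S' f cf Sv; case: no; exists S', f.
have KE : K E by exact: SK.
have chartK A : K A -> exists S' f, [/\ chart S' f, ranked S', S' A &
    r @` A = f @` A].
  move=> KA; have [S' [AS' SA' SE']] := AAex A E KA KE.
  have [_ rS' _ _] := apartment_facts rK axK AS' SE' cE.
  have [f [fi fE _]] := AAiso S' S E E AS' AS SE' SE' SE SE.
  have cf : chart S' f by [].
  exists S', f; split=> //; apply: eq_in_imfset => // v vA.
  by rewrite -(rP _ _ _ cf) //; apply: vertex_simplex vA.
exists r; split.
- move=> A /chartK[S' [f [[_ _ [_ fS _] _] _ SA ->]]]; exact: fS.
- move=> A [KA cA]; have [S' [f [[_ _ fi _] rS' SA ->]]] := chartK _ KA.
  by apply: isomorphism_chamber_map fi _ _.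
- move=> v Sv; symmetry; apply: (rP v S id) => //; split=> //; split=> //.
  - by move=> A SA; rewrite imfset_id.
  - by move=> A SA; exists A; rewrite ?imfset_id.
- move=> B /chartK[S' [f [[_ SE' [fI _ _] fE] rS' SB ->]]] fB.
  by apply: vertex_inj_imfset fI SB SE' _ => //; rewrite fB imfset_fixed.
Qed.

Lemma retraction_fixed K S E f A : ranked S -> retraction K S E f -> S A ->
  f @` A = A.
Proof.
by move=> rS [_ _ fS _] SA; apply: imfset_fixed => v /(vertex_simplex rS SA) /fS.
Qed.

Lemma apartment_convex K AA S i j A B E : ranked K -> apartment_axioms K AA ->
  AA S -> top_simplex S A -> top_simplex S B -> top_simplex K E ->
  near K i A E -> near K j E B -> (forall k, k < i + j -> ~ near K k A B) ->
  S E.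
Proof.
move=> rK axK AS tA tB; have [SA cA] := tA; have [SB cB] := tB.
have [SK rS gS thS] := apartment_facts rK axK AS SA cA.
elim: i j E => [|i IHi] j E tE /=; first by move <-.
move=> [F nAF FE] nEB far.
have tF : top_simplex K F by apply: near_top nAF; case: tA => /SK.
have SF : S F.
  apply: (IHi j.+1) => //; last by rewrite addnS -addSn.
  by case: FE => [->|adjFE]; [apply: nearS|apply: near_adj nEB].
case: FE => [<- //|adjFE]; have [_ _ neFE cP] := adjFE.
apply: contrapT => nSE.
have [G [tG PG neGF]] := thin_other rS thS cP (conj SF tF.2) (fsubsetIl _ _).
have [r rP] := exists_retraction rK axK AS tG.
have [_ rcm _ rG] := rP.
have rE : r @` E = F.
  apply: (@thin_third _ rS thS (F `&` E) G) => //.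
  - by split=> //; case: tF.
  - exact: rcm.
  - exact: fsubsetIl.
  - rewrite -(@retraction_fixed _ _ _ _ (F `&` E) rS rP).
      exact/sub_imfset/fsubsetIr.
    exact: sub_simplex rS SF (fsubsetIl _ _).
  - by move=> /(rG _ tE.1) eqEG; apply: nSE; rewrite eqEG; case: tG.
have nFB : near K j F B.
  apply: (near_sub SK).
  by have := chamber_map_near rcm nEB; rewrite rE (retraction_fixed rS rP SB).
case: (far ((i + j)%N)); [by rewrite addSn|exact: near_cat nAF nFB].
Qed.

(** * Foldings and reflected galleries *)

Section Folding.
Variables (S : set {fset V}) (f : V -> V) (C D : {fset V}).
Hypotheses (rS : ranked S) (thS : thin S) (foldf : folding S f).

Let fcm : chamber_map S S f.
Proof. by case: foldf => -[_ fC] _ _ A /(chamberE _ rS)/fC/(chamberE _ rS). Qed.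

Lemma folding_fixed B v : S B -> f @` B = B -> v \in B -> f v = v.
Proof.
case: foldf => _ ff _ SB fB; rewrite -{1}fB => /imfsetP[u /= uB ->].
exact/ff/(vertex_simplex rS SB uB).
Qed.

Lemma folding_idem B : S B -> f @` (f @` B) = f @` B.
Proof.
case: foldf => _ ff _ SB; apply: imfset_fixed => v /imfsetP[u /= uB ->].
exact/ff/(vertex_simplex rS SB uB).
Qed.

Lemma folding_fixed_sub B P : S B -> f @` B = B -> P `<=` B -> f @` P = P.
Proof.
move=> SB fB /fsubsetP PB; apply: imfset_fixed => v /PB.
exact: folding_fixed.
Qed.

Lemma folding_two A B E :
  top_simplex S A -> top_simplex S B -> top_simplex S E ->
  f @` A = f @` B -> f @` E = f @` A -> A <> B -> E <> A -> E = B.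
Proof.
move=> tA tB tE fAB fEA neAB neEA; case: foldf => _ _ two.
have [|X [Y [neXY XY]]] := two A; first exact/chamberE.
have toXY Z : top_simplex S Z -> f @` Z = f @` A -> Z = X \/ Z = Y.
  by move=> tZ fZ; apply/XY; split=> //; apply/chamberE.
have := toXY A tA erefl; have := toXY B tB (esym fAB); have := toXY E tE fEA.
by move=> [] ? [] ? [] ?; subst.
Qed.

(** The common panel is fixed along with [B], so [f] sends [A] to one of the two chambers on it. *)
Lemma folding_cross A B : adj S A B -> f @` B = B -> f @` A <> A -> f @` A = B.
Proof.
move=> [tA tB neAB cP] fB nfA.
apply: (@thin_third _ rS thS (A `&` B) A) => //.
- exact: fcm.
- exact: fsubsetIl.
- exact: fsubsetIr.
- rewrite -(folding_fixed_sub tB.1 fB (fsubsetIr A B)).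
  exact/sub_imfset/fsubsetIl.
Qed.

Lemma folding_near n A B : f @` A <> A -> f @` B = B -> near S n A B ->
  exists2 m, n = m.+1 & near S m (f @` A) B.
Proof.
elim: n B => [|n IHn] B nfA fB /=; first by move=> eqAB; rewrite eqAB in nfA.
move=> [E nAE EB]; exists n => //.
have [fE|nfE] := pselect (f @` E = E).
  by have [m -> nfAE] := IHn E nfA fE nAE; exists E.
case: EB => [eqEB|adjEB]; first by rewrite eqEB in nfE.
by rewrite -(folding_cross adjEB fB nfE); apply: (chamber_map_near fcm).
Qed.

Hypotheses (adjCD : adj S C D) (fD : f @` D = C).

(* A gallery starting at C is reflected into one starting at D: as long as it
   stays in the root, each of its chambers is replaced by the other chamber
   with the same image. *)
Lemma folding_reflect n B : near S n C B ->
  (f @` B = B -> exists B',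
     [/\ top_simplex S B', B' <> B, f @` B' = B & near S n D B']) /\
  (f @` B <> B -> exists2 m, n = m.+1 & near S m D B).
Proof.
have [tC tD neCD _] := adjCD.
have fC : f @` C = C by rewrite -fD folding_idem //; case: tD.
elim: n B => [|n IHn] B /=.
  by move <-; split=> // _; exists D; split=> //; apply/nesym.
move=> [A nCA AB]; have tA := near_top tC nCA.
have [IHfix IHmov] := IHn A nCA.
case: AB => [eqAB|adjAB].
  rewrite -eqAB; split=> [/IHfix[A' [tA' ne fA' nDA']]|].
    by exists A'; split=> //; exists A' => //; left.
  by move=> /IHmov[m -> nDA]; exists m.+1 => //; apply: nearS.
have [_ tB neAB cQ] := adjAB.
have [fA|nfA] := pselect (f @` A = A); last first.
  have {IHfix IHmov} [m -> nDA] := IHmov nfA; split=> [fB|nfB].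
    (* Coming back into the root: [A] is itself the mirror image of [B]. *)
    exists A; split=> //; first exact: folding_cross.
    by exists A; [exact: nearS|left].
  by exists m.+1 => //; exists A => //; right.
have {IHfix IHmov} [A' [tA' neA' fA' nDA']] := IHfix fA.
split=> [fB|nfB]; last first.
  have fBA := folding_cross (adjC adjAB) fA nfB.
  (* Leaving the root: only [A] and [A'] lie over [A]. *)
  have -> : B = A'.
    by apply: (@folding_two A); rewrite ?fA ?fA' //; apply/nesym.
  by exists n.
set Q := A `&` B in cQ; have QA : Q `<=` A := fsubsetIl _ _.
have QB : Q `<=` B := fsubsetIr _ _; clearbody Q.
have nQA' : ~ Q `<=` A'.
  move=> QA'; have eqA'B : A' = B by apply: (@thin_third _ rS thS Q A).
  by apply: neAB; rewrite -fA' eqA'B fB.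
(* With [A] and [B] both in the root, the mirror image of [B] is the chamber [H] across the face
   [Q'] of [A'] lying over [Q]. It is not fixed, since otherwise [Q'] would equal [Q] and [Q] would
   be a face of [A']. *)
pose Q' := [fset v in A' | f v \in Q].
have Q'A' : Q' `<=` A' by apply/fsubsetP => v; rewrite !inE => /andP[].
have fQ' : f @` Q' = Q.
  apply/fsetP => v; apply/imfsetP/idP => [[u /=]|vQ].
    by rewrite !inE => /andP[_ fuQ] ->.
  have /imfsetP[u /= uA' eqv] : v \in f @` A' by rewrite fA' (fsubsetP QA).
  by exists u => //; rewrite !inE uA' -eqv.
have cQ' : #|` Q'|.+1 = d.
  by rewrite -(chamber_map_card fcm tA' Q'A') fQ'.
have [H [tH Q'H neHA']] := thin_other rS thS cQ' tA' Q'A'.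
have nfH : f @` H <> H.
  move=> fH; apply: nQA'; rewrite -fQ'.
  by rewrite (folding_fixed_sub tH.1 fH Q'H).
have QfH : Q `<=` f @` H by rewrite -fQ'; apply: sub_imfset.
have fHB : f @` H = B.
  apply: (@thin_third _ rS thS Q A) => //; first exact: fcm.
  move=> fHA; have eqHA : H = A.
    by apply: (@folding_two A'); rewrite ?fA ?fA'.
  by apply: nfH; rewrite eqHA.
exists H; split=> //; first by move=> eqHB; apply: nfH; rewrite eqHB.
by exists A' => //; right; apply: adj_of_sub cQ' => //; apply/nesym.
Qed.

End Folding.

(** * Apartments that avoid a given vertex *)

Lemma apartment_avoiding_nearest K AA S x n B C D :
  ranked K -> thick K -> apartment_system K AA -> adj K C D ->
  AA S -> S C -> S D -> x \notin C ->
  top_simplex S B -> x \in B -> near S n C B ->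
  (forall m E, m < n -> top_simplex S E -> x \in E ->
     ~ near S m C E /\ ~ near S m D E) ->
  exists S', [/\ AA S', S' C, S' D & ~ S' [fset x]].
Proof.
move=> rK thK [AAsys AAcov] adjKCD AS SC SD xC tB xB nCB nearest.
have [[_ cC] [KD cD] neCD cCD] := adjKCD.
(* Members of [AA] may come from different families satisfying the axioms; each apartment is treated
   within its own. *)
have [AA1 ax1 AS1] := AAsys _ AS.
have [SK rS gS thS] := apartment_facts rK ax1 AS1 SC cC.
have tC : top_simplex S C by [].
have tD : top_simplex S D by [].
have adjCD : adj S C D by [].
have [_ /(_ C D)[|f [foldf fD]]] : thin S /\ forall C D, adjacent S C D ->
    exists f, folding S f /\ f @` D = C.
- by case: ax1 => /(_ S AS1)[_ [_ thS' foldS]].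
- exact/adjacentE.
case: n => [|n] in nCB nearest *; first by rewrite [C]nCB xB in xC.
have [_ reflB] := folding_reflect rS thS foldf adjCD fD nCB.
(* Otherwise reflection would give a gallery of length [n] from [D] to [B]. *)
have fB : f @` B = B.
  apply: contrapT => /reflB[m [<-] nDB].
  by have [_] := nearest n B (ltnSn n) tB xB; apply.
have nfD : f @` D <> D by rewrite fD.
(* Folding such a gallery would bring [B] within [n] of [C]. *)
have farS : ~ near S n.+1 D B.
  move/(folding_near rS thS foldf nfD fB) => [m [<-]]; rewrite fD => nCB'.
  by have [] := nearest n B (ltnSn n) tB xB.
case: nCB => E nCE EB; have tE := near_top tC nCE.
have xE : x \notin E.
  by apply/negP => xE; have [] := nearest n E (ltnSn n) tE xE.
have adjEB : adj S E B.
  by case: EB => // eqEB; rewrite eqEB xB in xE.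
have [_ _ neEB cQ] := adjEB; set Q := E `&` B in cQ.
have QE : Q `<=` E := fsubsetIl _ _; have QB : Q `<=` B := fsubsetIr _ _.
have SQ : S Q := sub_simplex rS tE.1 QE.
have xQ : x \notin Q by apply: contra xE; apply/fsubsetP.
clearbody Q.
have tKE : top_simplex K E by split; [exact: SK tE.1|exact: tE.2].
have tKB : top_simplex K B by split; [exact: SK tB.1|exact: tB.2].
have [B' [tB' QB' neB'E neB'B]] : exists B',
    [/\ top_simplex K B', Q `<=` B', B' <> E & B' <> B].
  have [X [Y [Z [[neXY neXZ neYZ] [[cX QX] [cY QY] [cZ QZ]]]]]] :=
    thK Q (panelI rK tKE QE cQ).
  move/(chamberE _ rK) in cX; move/(chamberE _ rK) in cY.
  move/(chamberE _ rK) in cZ.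
  have [XE|XE] := pselect (X = E); have [XB|XB] := pselect (X = B);
  have [YE|YE] := pselect (Y = E); have [YB|YB] := pselect (Y = B);
  (try by exists X); (try by exists Y); exists Z; split=> //; congruence.
(* [n.+1 + 1] is the length of the gallery from [D] through [C] and [E] to [B']. A shorter one would
   be retracted to one from [D] to [B]. *)
have far : forall k, k < n.+1 + 1 -> ~ near K k D B'.
  move=> k; rewrite addn1 ltnS => lek nDB'; apply: farS.
  have {nDB'} nDB' : near K n.+1 D B'.
    by rewrite -(subnKC lek); elim: (_ - _)%N => [|m IHm];
      rewrite ?addn0 // addnS; apply: nearS.
  have [r rP] := exists_retraction rK ax1 AS1 tE.
  have [_ rcm _ rE] := rP.
  have := chamber_map_near rcm nDB'; rewrite (retraction_fixed rS rP SD).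
  suff -> : r @` B' = B by [].
  apply: (@thin_third _ rS thS Q E) => //; first exact: rcm.
    by rewrite -(retraction_fixed rS rP SQ); apply: sub_imfset.
  by move/(rE _ tB'.1).
have [T [AT TD TB']] := AAcov D B' ((chamberE _ rK).2 (conj KD cD))
  ((chamberE _ rK).2 tB').
have [AA2 ax2 AT2] := AAsys _ AT.
have [TK rT gT thT] := apartment_facts rK ax2 AT2 TD cD.
have tTD : top_simplex T D by [].
have tTB' : top_simplex T B' by split=> //; exact: tB'.2.
have adjEB' : adj K E B' by apply: adj_of_sub cQ => //; apply/nesym.
have nKCE : near K n C E := near_sub SK nCE.
have adjDC := adjC adjKCD.
(* On this minimal gallery [C] comes after one step, and [E] after [n.+1]. *)
have TC : T C.
  apply: (@apartment_convex _ _ _ 1 n.+1 D B' C rK ax2 AT2) => //.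
  - by case: adjKCD.
  - by exists D => //; right.
  - by exists E => //; right.
  - by move=> k; rewrite addnC; apply: far.
have TE : T E.
  apply: (@apartment_convex _ _ _ n.+1 1 D B' E rK ax2 AT2) => //.
  - exact: near_adj nKCE.
  - by exists E => //; right.
exists T; split=> // Tx.
(* Any centre would do: the retraction fixes [x] and the vertices of [Q], hence [B], and so puts [B]
   in [T]. *)
have [r rP] := exists_retraction rK ax2 AT2 tTD.
have [rT' _ rfix _] := rP.
have eqB : B = x |` Q.
  apply/esym/eq_fset_card; first by rewrite fsubUset fsub1set xB.
  by rewrite cardfsU1 xQ add1n tB.2.
have TB : T B.
  rewrite -[B](@imfset_fixed r); first exact: rT' tKB.1.
  move=> v; rewrite eqB !inE => /orP[/eqP->|vQ]; first exact: rfix.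
  by apply/rfix/(vertex_simplex rT TE)/(fsubsetP QE).
(* [E], [B] and [B'] would be three chambers of [T] on [Q]. *)
apply: neB'B.
by apply: (@thin_third _ rT thT Q E) => //; split=> //; [exact: tE.2|exact: tB.2].
Qed.

Lemma apartment_avoiding K AA S x C D :
  ranked K -> thick K -> apartment_system K AA -> adj K C D ->
  AA S -> S C -> S D -> S [fset x] -> x \notin C -> x \notin D ->
  exists S', [/\ AA S', S' C, S' D & ~ S' [fset x]].
Proof.
move=> rK thK sysK adjCD AS SC SD Sx xC xD.
have [[_ cC] _ _ _] := adjCD; have [AAsys _] := sysK.
have [AA1 ax1 AS1] := AAsys _ AS.
have [SK rS gS thS] := apartment_facts rK ax1 AS1 SC cC.
pose reached m := exists B, [/\ top_simplex S B, x \in B &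
  near S m C B \/ near S m D B].
have [n reach_n] : exists n, reached n.
  have [B tB xB] := in_top_simplex rS Sx.
  have [n nCB] := gallery_near rS gS (conj SC cC) tB.
  by exists n, B; split=> //; [rewrite -fsub1set|left].
have [m /asboolP[B [tB xB nB]] min_m] :=
  ex_minnP (ex_intro (fun k => `[< reached k >]) n (asboolT reach_n)).
have nearest k E : k < m -> top_simplex S E -> x \in E ->
    ~ near S k C E /\ ~ near S k D E.
  move=> ltkm tE xE.
  by split=> nE; (have /min_m : `[< reached k >] by
    apply/asboolP; exists E; split=> //; by [left|right]); rewrite leqNgt ltkm.
case: nB => [nCB|nDB].
  exact: (apartment_avoiding_nearest rK thK sysK adjCD AS SC SD xC tB xB nCB).
(* When the minimum is attained from [D], the two chambers exchange roles. *)
have [|T [AT TD TC Tx]] := apartment_avoiding_nearest rK thK sysK (adjC adjCD)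
  AS SD SC xD tB xB nDB.
  by move=> k E ltkm tE xE; have [] := nearest k E ltkm tE xE.
by exists T.
Qed.

(** * Edges between adjacent chambers, and the intersection *)

Lemma coxeter_adjacent_noedge S C D v w : ranked S -> coxeter_complex S ->
  adj S C D -> v \in C -> v \notin D -> w \in D -> w \notin C ->
  ~ S [fset v; w].
Proof.
move=> rS [_ thS foldS] adjCD vC vD wD wC Svw.
have [tC tD neCD cP] := adjCD.
have [f [foldf fD]] := foldS C D ((adjacentE _ _ rS).2 adjCD).
have fcm : chamber_map S S f.
  by case: foldf => -[_ fC] _ _ A /(chamberE _ rS)/fC/(chamberE _ rS).
have fC : f @` C = C by rewrite -fD (folding_idem rS foldf) //; case: tD.
have fixC := folding_fixed rS foldf tC.1 fC.
(* The folding fixes the common panel and is injective on [D], so [w] can only go to the vertex of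
   [C] off the panel. *)
have fwv : f w = v.
  apply: (@corank1_eq (C `&` D) C); rewrite ?fsubsetIl ?cP ?tC.2 //.
  - by rewrite -fD in_imfset.
  - rewrite inE; apply/negP => /andP[fwC fwD].
    have eqfw : f w = w.
      by apply: (chamber_map_inj fcm tD); rewrite ?(fixC (f w)).
    by rewrite eqfw (negPf wC) in fwC.
  - by rewrite inE (negPf vD) andbF.
have [A tA /fsubsetP sA] := in_top_simplex rS Svw.
have eqvw : v = w.
  by apply: (chamber_map_inj fcm tA); rewrite ?sA ?inE ?eqxx ?orbT // fixC.
by rewrite eqvw wD in vD.
Qed.

End Apartments.

Theorem proposition2p5 (V : choiceType) (K : set {fset V})
    (AA : set (set {fset V})) (C D : {fset V}) :
  building K -> thick K -> apartment_system K AA -> adjacent K C D ->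
  [set X : {fset V} | (X `<=` C)%fset \/ (X `<=` D)%fset] =
  \bigcap_(S in [set S : set {fset V} | [/\ AA S, S C & S D]]) S.
Proof.
move=> [[sK [d [leK cK]] _] _] thK sysK adjCD.
have rK : ranked d K by [].
have {}adjCD : adj d K C D by apply/adjacentE.
have [tC tD neCD cP] := adjCD; have [AAsys AAcov] := sysK.
have facts S : AA S -> S C -> [/\ ranked d S & coxeter_complex S].
  move=> AS SC; have [AA1 ax1 AS1] := AAsys _ AS.
  have [_ rS _ _] := apartment_facts rK ax1 AS1 SC tC.2.
  by split=> //; case: ax1 => /(_ S AS1)[].
apply/seteqP; split=> X /=.
  move=> XCD S /= [AS SC SD]; have [rS _] := facts S AS SC.
  by case: XCD; apply: (sub_simplex rS).
move=> Xin.
have [S0 [AS SC SD]] := AAcov C D ((chamberE _ rK).2 tC) ((chamberE _ rK).2 tD).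
have [rS coxS] := facts S0 AS SC.
have SX : S0 X by apply: Xin.
(* A vertex outside [C] and [D] is missed by some apartment of the intersection, whereas each of
   them contains [X]. *)
have XCD u : u \in X -> (u \in C) || (u \in D).
  move=> uX; apply: contrapT => /negP; rewrite negb_or => /andP[uC uD].
  have [S [AS' SC' SD']] := apartment_avoiding rK thK sysK adjCD AS SC SD
    (vertex_simplex rS SX uX) uC uD.
  by apply; apply: (vertex_simplex (facts S AS' SC').1 _ uX); apply: Xin.
(* If [X] lay in neither chamber, it would contain an edge from a vertex [v] of [C] alone to a
   vertex [w] of [D] alone. *)
apply: contrapT => /not_orP[/negP/fsubsetPn[w wX wC] /negP/fsubsetPn[v vX vD]].
have wD : w \in D by have := XCD w wX; rewrite (negPf wC).
have vC : v \in C by have := XCD v vX; rewrite (negPf vD) orbF.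
have adjS : adj d S0 C D by case: tC tD => _ ? [_ ?].
apply: (coxeter_adjacent_noedge rS coxS adjS vC vD wD wC).
apply: (sub_simplex rS SX); apply/fsubsetP => u.
by rewrite !inE => /orP[] /eqP->.
Qed.
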